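(* Let $\mathsf X\in\{\mathrm{Stela},\mathrm{Carla}\}$ and $k\ge1$, and fix an optimal dual solution of the LP relaxation of $\mathrm{RMP}^{\mathsf X}_k$, with stratified dual $\bar\mu^{\mathsf X}_k$ and $\gamma^{\mathsf X}_t=-\psi^{\mathsf X}_t$. Then $-\bar\mu^{\mathsf X}_k(a,t)\ge0$ for all $(a,t)\in\mathcal A_T$, $\gamma^{\mathsf X}_t\ge0$ for all $t\in T^*$, and for every $d\in D$ the rank-$k$ reduced cost of $\pi\in\Pi_d$ in $\mathrm{RMP}^{\mathsf X}_k$ is $$\bar c^{\mathsf X}_{d,k}(\pi)=-\alpha^{\mathsf X}_d+\sum_{(a,t)\in\mathcal A_T}\bigl(-\bar\mu^{\mathsf X}_k(a,t)\bigr)\Gamma_{d,a,t}(\pi)+\sum_{t\in T^*}\gamma^{\mathsf X}_t\,\beta_{d,t}(\pi).$$ Moreover, setting $\theta^{\mathsf X}_{d,k}(i,j,t)=\sum_{a:(a,t)\in\mathcal A_T}(-\bar\mu^{\mathsf X}_k(a,t))\frac{\nu(d,t)}{c(a)}r(i,j,a,t)\ge0$, the pricing subproblem of minimizing $\bar c^{\mathsf X}_{d,k}(\pi)+\alpha^{\mathsf X}_d$ over $\pi\in\Pi_d$ is $$\operatorname{val}(\mathrm{SP}^{\mathsf X}_{d,k})=\min_{\pi=(p^{(0)},\dots,p^{(h-1)})\in\Pi_d}\Bigl\{\sum_{t\in T}\ \sum_{(i,j)\in\operatorname{segs}(p^{(t)})}\theta^{\mathsf X}_{d,k}(i,j,t)+\sum_{t\in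 T^*}\gamma^{\mathsf X}_t\operatorname{dist}(p^{(t-1)},p^{(t)})\Bigr\},$$ whose feasible set $\Pi_d$ (bounded-hop paths with at most $\mathrm{maxSeg}$ segments, coupled along the chain of consecutive periods) does not depend on $(\mathsf X,k)$, and whose nonnegative data $(\theta^{\mathsf X}_{d,k},\gamma^{\mathsf X})$ do.
   Context: Setting ($T$-ASR instance). $G=(V,A)$ is a finite directed graph with arc weights $\omega:A\to\mathbb Q_{>0}$ and capacities $c:A\to\mathbb Q_{>0}$. $T=\{0,\dots,h-1\}$, $h\ge1$, $T^*=T\setminus\{0\}$. $q:T\to2^A$, $q(0)=\varnothing$, $G_t=(V,A\setminus q(t))$, $\mathcal A_T=\{(a,t):t\in T,a\in A\setminus q(t)\}$. $D$ is a finite set of demands $d$ with source $s_d$ and target $t_d$ in $V$; volumes $\nu:D\times T\to\mathbb Q_{\ge0}$, budgets $\kappa:T^*\to\mathbb N$, integer $\mathrm{maxSeg}\ge2$. The forwarding graph from $u$ to $v$ at $t$ consists of the arcs of $G_t$ on $\omega$-shortest $u$–$v$ paths; $r(u,v,a,t)\ge0$ is the fraction of a unit $u$–$v$ flow using arc $a$ when flow entering each vertex is split equally among its outgoing arcs in this graph ($0$ if $a$ is not in it). A segment valid at $t$ is $(i,j)$, $i\neq j$, with $j$ reachable from $i$ in $G_t$. A segment path of $d$ at $t$ is a node sequence from $s_d$ to $t_d$ with at least one and at most $\mathrm{maxSeg}$ segments (pairs of consecutive nodes), all valid at $t$ and pairwise distinct (nodes may repeat). $\operatorname{segs}(p)$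 is its set of segments, $\delta(p,ij)=1$ if $(i,j)\in\operatorname{segs}(p)$, else $0$; $\operatorname{dist}(p,p')=\sum_{i\ne j}|\delta(p,ij)-\delta(p',ij)|$. $\Pi_d$ is the set of trajectories $\pi=(p^{(0)},\dots,p^{(h-1)})$, $p^{(t)}$ a segment path of $d$ at $t$. $\Gamma_{d,a,t}(\pi)=\frac{\nu(d,t)}{c(a)}\sum_{i,j}r(i,j,a,t)\delta(p^{(t)},ij)$, $\beta_{d,t}(\pi)=\operatorname{dist}(p^{(t-1)},p^{(t)})$. Restricted masters. Pools $\Pi_d^{\mathrm{pool}}\subseteq\Pi_d$ are finite and such that the masters are feasible. $\bar\lambda_1\ge\dots\ge\bar\lambda_{k-1}\ge0$ are the constants certified at earlier ranks. Core rows, common to all masters, with $\xi_{d,\pi}\ge0$ (LP relaxation), $\lambda(a,t)$ free: $(\mathrm S)$ $\sum_{\pi\in\Pi_d^{\mathrm{pool}}}\xi_{d,\pi}=1$, $d\in D$ $[\alpha_d]$; $(\mathrm L)$ $\lambda(a,t)-\sum_d\sum_\pi\Gamma_{d,a,t}(\pi)\xi_{d,\pi}=0$, $(a,t)\in\mathcal A_T$ $[\eta_{a,t}]$; $(\mathrm B)$ $\sum_d\sum_\pi\beta_{d,t}(\pi)\xi_{d,\pi}\le\kappa(t)$, $t\in T^*$ $[\psi_t]$. Multipliers are in brackets. LP relaxation of $\mathrm{RMP}^{\mathrm{Stela}}_k$: for $k=1$, min $U$ (free) s.t. core and $\lambda(a,t)-U\le0$ $[\mu_1(a,t)]$. For $k\ge2$,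 min $z$ s.t. core; $\lambda(a,t)\le\bar\lambda_1$ $[\nu_1(a,t)]$; $\lambda(a,t)-(\bar\lambda_1-\bar\lambda_j)y^{(j)}_{a,t}\le\bar\lambda_j$, $2\le j\le k-1$ $[\nu_j(a,t)]$; $\sum_{(a,t)}y^{(j)}_{a,t}\le j-1$, $2\le j\le k$ $[\rho_j]$; $\lambda(a,t)-z-\bar\lambda_1y^{(k)}_{a,t}\le0$ $[\mu_k(a,t)]$; $z\le\bar\lambda_{k-1}$ $[\sigma]$; $y^{(j)}_{a,t}\le1$, $2\le j\le k$; $z\ge0$, $y^{(j)}_{a,t}\ge0$. LP relaxation of $\mathrm{RMP}^{\mathrm{Carla}}_k$: for $k=1$, min $z_1+\sum_{(a,t)}u_{a,t}$ s.t. core and $\lambda(a,t)-z_1-u_{a,t}\le0$ $[\mu_1(a,t)]$, $u_{a,t}\ge0$, $z_1$ free. For $k\ge2$, min $k z_k+\sum_{(a,t)}u^{(k)}_{a,t}$ s.t. core; $\lambda(a,t)-z_k-u^{(k)}_{a,t}\le0$ $[\mu_k(a,t)]$; $\lambda(a,t)-u^{(j)}_{a,t}\le\bar\lambda_j$, $j<k$ $[\nu_j(a,t)]$; $\sum_{(a,t)}u^{(j)}_{a,t}\le c_j:=\sum_{r<j}(\bar\lambda_r-\bar\lambda_j)$, $j<k$ $[\rho_j]$; $z_k\le\bar\lambda_{k-1}$ $[\sigma]$; $z_k,u^{(k)}_{a,t},u^{(j)}_{a,t}\ge0$. Dual conventions (minimization primal): equality rows have free multipliers, $\le$ rows have nonpositive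 multipliers; a free primal variable yields a dual equality (sum over rows of multiplier times coefficient equals objective coefficient), a nonnegative one yields $\le$. The stratified dual is $\bar\mu^{\mathsf X}_k(a,t)=\mu^{\mathsf X}_k(a,t)+\sum_{j<k}\nu^{\mathsf X}_j(a,t)$. The reduced cost of a trajectory $\pi\in\Pi_d$ (in the pool or not) is the objective coefficient of $\xi_{d,\pi}$ minus the sum over rows of multiplier times the coefficient that $\xi_{d,\pi}$ has (or would have) in the row. *)

(* Defs.v *)
From HB Require Import structures.
From mathcomp Require Import all_boot all_order all_algebra.
From mathcomp Require Import finmap.
Set Implicit Arguments.
Unset Strict Implicit.
Unset Printing Implicit Defensive.
Import Order.TTheory GRing.Theory Num.Theory.
Local Open Scope ring_scope.

(* Periods are the elements of 'I_horizon; the budget at period 0 is never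
   used. *)
Record instance := Instance {
  vertex : finType;
  arc : finType;
  demand : finType;
  src : arc -> vertex;
  tgt : arc -> vertex;
  weight : arc -> rat;
  capacity : arc -> rat;
  horizon : nat;
  failed : 'I_horizon -> {set arc};
  dsrc : demand -> vertex;
  dtgt : demand -> vertex;
  volume : demand -> 'I_horizon -> rat;
  budget : 'I_horizon -> nat;
  maxSeg : nat;
  weight_gt0 : forall a, 0 < weight a;
  capacity_gt0 : forall a, 0 < capacity a;
  horizon_gt0 : (0 < horizon)%N;
  failed0 : forall t : 'I_horizon, t = 0%N :> nat -> failed t = set0;
  volume_ge0 : forall d t, 0 <= volume d t;
  maxSeg_ge2 : (2 <= maxSeg)%N
}.

Section Network.
Variable I : instance.
Local Notation V := (vertex I).
Local Notation A := (arc I).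
Local Notation D := (demand I).
Local Notation T := 'I_(horizon I).

Definition alive (t : T) (a : A) : bool := a \notin failed t.

Definition arcTimes : {set A * T} := [set x | alive x.2 x.1].

Definition later (t : T) : bool := (0 < t)%N.

(* The vertices visited by p are u :: map tgt p, and no vertex is repeated. *)
Definition arcPath (t : T) (u v : V) (p : seq A) : bool :=
  [&& all (alive t) p,
      map (@src I) p == belast u (map (@tgt I) p),
      last u (map (@tgt I) p) == v
    & uniq (u :: map (@tgt I) p)].

Definition pathWeight (p : seq A) : rat := \sum_(a <- p) weight a.

(* A path has fewer than #|V| arcs because its vertices are distinct, so the
   bounded quantification below ranges over all paths. *)
Definition shortestPath (t : T) (u v : V) (p : seq A) : bool :=
  arcPath t u v p &&
  [forall n : 'I_#|V|, forall p' : (nat_of_ord n).-tuple A,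
     arcPath t u v p' ==> (pathWeight p <= pathWeight p')].

Definition forwarding (t : T) (u v : V) (a : A) : bool :=
  [exists n : 'I_#|V|, exists p : (nat_of_ord n).-tuple A,
     shortestPath t u v p && (a \in (p : seq A))].

Definition outdeg (t : T) (u v w : V) : nat :=
  #|[set b | forwarding t u v b & src b == w]|.

Definition spread (t : T) (u v : V) (f : V -> rat) : V -> rat :=
  fun w => (w == u)%:R +
    \sum_(b | forwarding t u v b && (tgt b == w))
       f (src b) / (outdeg t u v (src b))%:R.

(* As weights are positive the forwarding graph is acyclic, so #|V| rounds of
   propagation reach the unique fixed point of [spread], i.e. the flow entering
   each vertex when one unit is injected at u. *)
Definition inflow (t : T) (u v : V) : V -> rat :=
  iter #|V| (spread t u v) (fun=> 0).

Definition splitRatio (u v : V) (a : A) (t : T) : rat :=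
  if forwarding t u v a
  then inflow t u v (src a) / (outdeg t u v (src a))%:R else 0.

Definition reachable (t : T) : rel V :=
  connect [rel x y | [exists a, [&& alive t a, src a == x & tgt a == y]]].

Definition validSegment (t : T) (s : V * V) : bool :=
  (s.1 != s.2) && reachable t s.1 s.2.

Definition segments (p : seq V) : seq (V * V) := zip p (behead p).

Definition segPath (d : D) (t : T) (p : seq V) : bool :=
  [&& head (dtgt d) p == dsrc d,
      last (dsrc d) p == dtgt d,
      (0 < size (segments p) <= maxSeg I)%N,
      all (validSegment t) (segments p)
    & uniq (segments p)].

Definition segs (p : seq V) : {set V * V} := [set s in segments p].

Definition delta (p : seq V) (s : V * V) : rat := (s \in segs p)%:R.

Definition dist (p p' : seq V) : rat :=
  \sum_(s : V * V | s.1 != s.2) `|delta p s - delta p' s|.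

Definition trajectory := {ffun T -> seq V}.

Definition Pi (d : D) : pred trajectory :=
  fun pi => [forall t : T, segPath d t (pi t)].

Definition Gamma (d : D) (a : A) (t : T) (pi : trajectory) : rat :=
  volume d t / capacity a *
  \sum_(i : V) \sum_(j : V) splitRatio i j a t * delta (pi t) (i, j).

(* [ord_pred t] is the period t - 1 when t > 0. *)
Definition beta (d : D) (t : T) (pi : trajectory) : rat :=
  dist (pi (ord_pred t)) (pi t).

End Network.

(* [coef] is defined for all columns, also those outside of [cols], so that the
   reduced cost of a column that is not in the program makes sense. *)
Record linearProgram (R : Type) (row col : Type) := LinearProgram {
  rows : seq row;
  cols : seq col;
  eqRow : pred row;   (* the other rows are <= rows *)
  freeCol : pred col; (* the other columns are nonnegative *)
  obj : col -> R;
  coef : row -> col -> R;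
  rhs : row -> R
}.

Section Duality.
Variables (R : realFieldType) (row col : Type) (P : linearProgram R row col).

Definition primalFeasible (x : col -> R) : bool :=
  all (fun r => let lhs := \sum_(c <- cols P) coef P r c * x c in
                if eqRow P r then lhs == rhs P r else lhs <= rhs P r) (rows P)
  && all (fun c => freeCol P c || (0 <= x c)) (cols P).

Definition dualFeasible (y : row -> R) : bool :=
  all (fun r => eqRow P r || (y r <= 0)) (rows P)
  && all (fun c => let lhs := \sum_(r <- rows P) y r * coef P r c in
                   if freeCol P c then lhs == obj P c else lhs <= obj P c)
         (cols P).

Definition dualValue (y : row -> R) : R := \sum_(r <- rows P) y r * rhs P r.

Definition dualOptimal (y : row -> R) : Prop :=
  dualFeasible y /\ forall y', dualFeasible y' -> dualValue y' <= dualValue y.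

Definition reducedCost (y : row -> R) (c : col) : R :=
  obj P c - \sum_(r <- rows P) y r * coef P r c.

End Duality.

Variant model := Stela | Carla.

(* Rows are named after their multipliers; [YboundRow j] is y^(j) <= 1. *)
Inductive mrow (I : instance) : Type :=
| AlphaRow of demand I
| EtaRow of arc I * 'I_(horizon I)
| PsiRow of 'I_(horizon I)
| MuRow of arc I * 'I_(horizon I)
| NuRow of nat & arc I * 'I_(horizon I)
| RhoRow of nat
| SigmaRow
| YboundRow of nat & arc I * 'I_(horizon I).
Arguments RhoRow {I} _.
Arguments SigmaRow {I}.

(* [ZCol] is U, z, z_1 or z_k; [AuxCol j] is y^(j) for Stela, u^(j) for Carla. *)
Inductive mcol (I : instance) : Type :=
| XiCol of demand I & trajectory I
| LambdaCol of arc I * 'I_(horizon I)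
| ZCol
| AuxCol of nat & arc I * 'I_(horizon I).
Arguments ZCol {I}.

Section Master.
Variables (R : realFieldType) (I : instance).
Variables (pool : demand I -> {fset trajectory I}) (lbar : nat -> R).
Variables (X : model) (k : nat).

Definition carlaRhs (j : nat) : R := \sum_(1 <= i < j) (lbar i - lbar j).

(* The ranges of j follow the case k >= 2; for k = 1 they are empty, except that
   Carla keeps u^(1), so that only the core rows and the mu rows remain. *)
Definition rhoRange : seq nat :=
  if X is Stela then index_iota 2 k.+1 else index_iota 1 k.

Definition auxRange : seq nat :=
  if X is Stela then index_iota 2 k.+1 else index_iota 1 k.+1.

Definition masterRows : seq (mrow I) :=
  [seq AlphaRow d | d <- enum (demand I)]
  ++ [seq EtaRow x | x <- enum (arcTimes I)]
  ++ [seq PsiRow t | t <- enum (@later I)]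
  ++ [seq MuRow x | x <- enum (arcTimes I)]
  ++ [seq NuRow j x | j <- index_iota 1 k, x <- enum (arcTimes I)]
  ++ [seq RhoRow j | j <- rhoRange]
  ++ (if (1 < k)%N then [:: SigmaRow] else [::])
  ++ (if X is Stela
      then [seq YboundRow j x | j <- auxRange, x <- enum (arcTimes I)]
      else [::]).

Definition masterCols : seq (mcol I) :=
  [seq XiCol d pi | d <- enum (demand I), pi <- enum_fset (pool d)]
  ++ [seq LambdaCol x | x <- enum (arcTimes I)]
  ++ [:: ZCol]
  ++ [seq AuxCol j x | j <- auxRange, x <- enum (arcTimes I)].

Definition masterEqRow (r : mrow I) : bool :=
  match r with AlphaRow _ | EtaRow _ => true | _ => false end.

Definition masterFreeCol (c : mcol I) : bool :=
  match c with LambdaCol _ => true | ZCol => k == 1%N | _ => false end.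

Definition masterObj (c : mcol I) : R :=
  match X, c with
  | Stela, ZCol => 1
  | Carla, ZCol => k%:R
  | Carla, AuxCol j _ => (j == k)%:R
  | _, _ => 0
  end.

Definition masterCoef (r : mrow I) (c : mcol I) : R :=
  match r, c with
  | AlphaRow d, XiCol d' _ => (d == d')%:R
  | EtaRow x, LambdaCol x' => (x == x')%:R
  | EtaRow x, XiCol d pi => - ratr (Gamma d x.1 x.2 pi)
  | PsiRow t, XiCol d pi => ratr (beta d t pi)
  | MuRow x, LambdaCol x' => (x == x')%:R
  | MuRow _, ZCol => -1
  | MuRow x, AuxCol j x' =>
      if (j == k) && (x == x')
      then (if X is Stela then - lbar 1 else -1) else 0
  | NuRow _ x, LambdaCol x' => (x == x')%:R
  | NuRow j x, AuxCol j' x' =>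
      if (j == j') && (x == x')
      then (if X is Stela then - (lbar 1 - lbar j) else -1) else 0
  | RhoRow j, AuxCol j' _ => (j == j')%:R
  | SigmaRow, ZCol => 1
  | YboundRow j x, AuxCol j' x' => ((j == j') && (x == x'))%:R
  | _, _ => 0
  end.

Definition masterRhs (r : mrow I) : R :=
  match r with
  | AlphaRow _ => 1
  | EtaRow _ => 0
  | PsiRow t => (budget t)%:R
  | MuRow _ => 0
  | NuRow j _ => lbar j
  | RhoRow j => if X is Stela then j.-1%:R else carlaRhs j
  | SigmaRow => lbar k.-1
  | YboundRow _ _ => 1
  end.

Definition master : linearProgram R (mrow I) (mcol I) :=
  LinearProgram masterRows masterCols masterEqRow masterFreeCol
                masterObj masterCoef masterRhs.

Definition masterSetting : Prop :=
  [/\ (0 < k)%N,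
      forall d pi, pi \in pool d -> Pi d pi,
      forall i j, (0 < i)%N -> (i <= j)%N -> (j < k)%N ->
        0 <= lbar j <= lbar i
    & exists x, primalFeasible master x].

End Master.

Section Pricing.
Variables (R : realFieldType) (I : instance) (k : nat) (y : mrow I -> R).

Definition stratifiedDual (x : arc I * 'I_(horizon I)) : R :=
  y (MuRow x) + \sum_(1 <= j < k) y (NuRow j x).

Definition gamma (t : 'I_(horizon I)) : R := - y (PsiRow t).

Definition theta (d : demand I) (i j : vertex I) (t : 'I_(horizon I)) : R :=
  \sum_(a | (a, t) \in arcTimes I)
     - stratifiedDual (a, t)
     * ratr (volume d t / capacity a * splitRatio i j a t).

End Pricing.

Record minProblem (R T : Type) := MinProblem {
  feasible : pred T;
  objective : T -> R
}.

Definition isMinimum (R : realFieldType) (T : Type) (P : minProblem R T)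
    (v : R) : Prop :=
  (exists2 x, feasible P x & objective P x = v)
  /\ forall x, feasible P x -> v <= objective P x.

Definition pricing (R : realFieldType) (I : instance)
    (pool : demand I -> {fset trajectory I}) (lbar : nat -> R)
    (X : model) (k : nat) (y : mrow I -> R) (d : demand I) :
    minProblem R (trajectory I) :=
  MinProblem (Pi d)
    (fun pi => reducedCost (master pool lbar X k) y (XiCol d pi)
               + y (AlphaRow d)).

Definition chainProblem (R : realFieldType) (I : instance) (d : demand I)
    (th : vertex I -> vertex I -> 'I_(horizon I) -> R)
    (ga : 'I_(horizon I) -> R) : minProblem R (trajectory I) :=
  MinProblem (Pi d)
    (fun pi => \sum_(t : 'I_(horizon I)) \sum_(s in segs (pi t)) th s.1 s.2 t
               + \sum_(t | later t)
                   ga t * ratr (dist (pi (ord_pred t)) (pi t))).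

(* Main.v *)
Require Import Defs.
From HB Require Import structures.
From mathcomp Require Import all_boot all_order all_algebra.
From mathcomp Require Import finmap lra.
Set Implicit Arguments.
Unset Strict Implicit.
Unset Printing Implicit Defensive.
Import Order.TTheory GRing.Theory Num.Theory.
Local Open Scope ring_scope.

(* The dual equality of the free column lambda(a, t) reads
   eta_{a,t} = - stratifiedDual(a, t); substituting it in the link rows gives
   the reduced cost, and the minimum exists because segment paths have bounded
   length. For the dependence on k, take one arc of load 1 and lbar = 2: at
   rank 1 the column U forces the stratified dual to be -1, whereas at rank 2
   the only arc may be the excepted one, the optimal value is 0, and every
   optimal stratified dual vanishes. *)

(** * Nonnegativity of flows and load coefficients *)

Section Nonnegativity.
Variable I : instance.

Lemma inflow_ge0 t u v (w : vertex I) : 0 <= inflow t u v w.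
Proof.
rewrite /inflow; elim: #|vertex I| w => [|n IHn] w //=.
by rewrite addr_ge0 ?ler0n// sumr_ge0 // => b _; rewrite divr_ge0 ?ler0n.
Qed.

Lemma splitRatio_ge0 u v (a : Defs.arc I) t : 0 <= splitRatio u v a t.
Proof.
by rewrite /splitRatio; case: ifP => // _; rewrite divr_ge0 ?inflow_ge0 ?ler0n.
Qed.

Lemma load_ge0 d i j (a : Defs.arc I) t :
  0 <= volume d t / capacity a * splitRatio i j a t.
Proof.
by rewrite mulr_ge0 ?splitRatio_ge0 ?divr_ge0 ?volume_ge0 ?ltW ?capacity_gt0.
Qed.

End Nonnegativity.

(** * Signs, reduced costs and pricing under dual feasibility *)

Section Duals.
Variables (R : realFieldType) (I : instance).
Variables (pool : demand I -> {fset trajectory I}) (lbar : nat -> R).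
Variables (X : model) (k : nat).
Implicit Types (y : mrow I -> R) (d : demand I) (pi : trajectory I).
Local Notation M := (master pool lbar X k).

(** Grouping the rows by family lets simplification of [masterCoef] read off a whole column, for
    both models and all ranks at once. *)
Lemma big_masterRows (F : mrow I -> R) :
  \sum_(r <- masterRows I X k) F r =
  \sum_d F (AlphaRow d) + \sum_(x in arcTimes I) F (EtaRow x)
  + \sum_(t | later t) F (PsiRow t) + \sum_(x in arcTimes I) F (MuRow x)
  + \sum_(1 <= j < k) \sum_(x in arcTimes I) F (NuRow j x)
  + \sum_(j <- rhoRange X k) F (RhoRow j)
  + (if (1 < k)%N then F SigmaRow else 0)
  + (if X is Stela then
       \sum_(j <- auxRange X k) \sum_(x in arcTimes I) F (YboundRow j x)
     else 0).
Proof.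
rewrite /masterRows !big_cat !big_map /= -!addrA; do ![congr (_ + _)].
- exact: big_enum.
- exact: big_enum.
- exact: big_enum.
- by rewrite big_allpairs_dep; apply: eq_bigr => j _; rewrite big_enum.
- by case: ifP; rewrite ?big_seq1 ?big_nil.
case: X; last by rewrite big_nil.
by rewrite big_allpairs_dep; apply: eq_bigr => j _; rewrite big_enum.
Qed.

Lemma dualFeasible_row y : dualFeasible M y ->
  [/\ forall t, later t -> y (PsiRow t) <= 0,
      forall x, x \in arcTimes I -> y (MuRow x) <= 0
    & forall j x, (0 < j < k)%N -> x \in arcTimes I -> y (NuRow j x) <= 0].
Proof.
case/andP=> + _; rewrite /= /masterRows !all_cat !all_map.
(* The two blocks dropped first are the equality rows, which carry no sign condition. *)
case/and5P=> _ _ /allP psi /allP mu /andP[/all_allpairsP nu _].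
split=> [t lt_t|x xA|j x jk xA].
- by apply: psi; rewrite mem_enum.
- by apply: mu; rewrite mem_enum.
- by apply: nu; rewrite ?mem_enum ?mem_index_iota.
Qed.

Lemma stratifiedDual_le0 y x :
  dualFeasible M y -> x \in arcTimes I -> stratifiedDual k y x <= 0.
Proof.
case/dualFeasible_row=> _ mu nu xA; rewrite -oppr_ge0 opprD -sumrN.
rewrite addr_ge0 ?oppr_ge0 ?mu // big_nat_cond sumr_ge0 // => j /andP[jk _].
by rewrite oppr_ge0 nu.
Qed.

Lemma gamma_ge0 y t : dualFeasible M y -> later t -> 0 <= gamma y t.
Proof. by case/dualFeasible_row=> psi _ _ lt_t; rewrite oppr_ge0 psi. Qed.

Lemma sum_mul_delta (T : finType) (A : {set T}) (f : T -> R) x : x \in A ->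
  \sum_(x' in A) f x' * (x' == x)%:R = f x.
Proof.
move=> xA; rewrite (bigD1 x) //= eqxx mulr1 big1 ?addr0 // => x' /andP[_ nx].
by rewrite (negPf nx) mulr0.
Qed.

Lemma sum_mul0 (T : Type) (r : seq T) (P : pred T) (f : T -> R) :
  \sum_(i <- r | P i) f i * 0 = 0.
Proof. by rewrite -mulr_suml mulr0. Qed.

Lemma eta_stratifiedDual y x : dualFeasible M y -> x \in arcTimes I ->
  y (EtaRow x) = - stratifiedDual k y x.
Proof.
case/andP=> _ + xA; rewrite /= /masterCols !all_cat !all_map.
case/and3P=> _ /allP/(_ x) + _; rewrite mem_enum /= => /(_ xA).
rewrite big_masterRows /= => /eqP.
(* [masterObj] and the last block of rows match on the model first, so they reduce to 0 only after a
   case split. *)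
have -> : masterObj R X k (LambdaCol x) = 0 by rewrite /masterObj; case: X.
rewrite !sum_mul0 !sum_mul_delta // mulr0 if_same.
under [\sum_(1 <= j < k) _]eq_bigr do rewrite sum_mul_delta //.
under [\sum_(j <- auxRange X k) _]eq_bigr do rewrite sum_mul0.
rewrite big1_eq (_ : (if X is Stela then 0 else 0) = 0 :> R); last by case: X.
rewrite !addr0 add0r -addrA => /eqP.
by rewrite addr_eq0 => /eqP.
Qed.

(** The column has zero cost and meets only the alpha, eta and psi rows; its eta coefficients
    -Gamma, with eta replaced by minus the stratified dual, give the middle sum. Here [pi] is any
    trajectory, as pricing seeks columns outside the pool. *)
Lemma reducedCost_xi y d pi : dualFeasible M y ->
  reducedCost M y (XiCol d pi) =
  - y (AlphaRow d)
  + \sum_(x in arcTimes I) - stratifiedDual k y x * ratr (Gamma d x.1 x.2 pi)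
  + \sum_(t | later t) gamma y t * ratr (beta d t pi).
Proof.
move=> fy; rewrite /reducedCost /= big_masterRows /=.
have -> : masterObj R X k (XiCol d pi) = 0 by rewrite /masterObj; case: X.
rewrite (bigD1 d) //= eqxx mulr1 big1 => [|d' /negPf->]; last by rewrite mulr0.
rewrite !sum_mul0 mulr0 if_same.
under [\sum_(1 <= j < k) _]eq_bigr do rewrite sum_mul0.
under [\sum_(j <- auxRange X k) _]eq_bigr do rewrite sum_mul0.
rewrite !big1_eq (_ : (if X is Stela then 0 else 0) = 0 :> R); last by case: X.
rewrite !addr0 sub0r !opprD -!sumrN; congr (_ + _ + _).
  by apply: eq_bigr => x xA; rewrite mulrN opprK eta_stratifiedDual.
by apply: eq_bigr => t _; rewrite -mulNr.
Qed.

Lemma theta_ge0 y d i j t : dualFeasible M y -> 0 <= theta k y d i j t.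
Proof.
move=> fy; apply: sumr_ge0 => a aA.
by rewrite mulr_ge0 ?oppr_ge0 ?stratifiedDual_le0 // ler0q load_ge0.
Qed.

(** [Gamma] is linear in the indicators [delta] of the path at the same period, so exchanging the
    sums over arcs and segments collects the coefficient [theta] of each segment. *)
Lemma sum_Gamma_theta y d pi :
  \sum_(x in arcTimes I) - stratifiedDual k y x * ratr (Gamma d x.1 x.2 pi) =
  \sum_t \sum_(s in segs (pi t)) theta k y d s.1 s.2 t.
Proof.
transitivity (\sum_t \sum_(a | (a, t) \in arcTimes I)
    - stratifiedDual k y (a, t) * ratr (Gamma d a t pi)).
  by rewrite (exchange_big_dep predT) //= pair_big_dep /=; apply: eq_big => -[].
apply: eq_bigr => t _; rewrite exchange_big /=; apply: eq_bigr => a _.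
rewrite -mulr_sumr -rmorph_sum; congr (_ * ratr _).
rewrite /Gamma -mulr_sumr; congr (_ * _).
(* The sum over [segs] becomes a sum over all node pairs, with [delta] as the indicator. *)
rewrite pair_bigA /= [RHS]big_mkcond; apply: eq_bigr => -[i j] _ /=.
by rewrite /delta; case: ifP; rewrite ?mulr1 ?mulr0.
Qed.

Lemma objective_pricing y d : dualFeasible M y ->
  objective (pricing pool lbar X k y d) =1
  objective (chainProblem d (theta k y d) (gamma y)).
Proof.
move=> fy pi /=; rewrite reducedCost_xi // sum_Gamma_theta.
by rewrite addrC -!addrA addNKr.
Qed.

(** With an empty pool the row [AlphaRow d] would read 0 = 1. This supplies the trajectory needed
    for the pricing minimum to exist. *)
Lemma primalFeasible_pool_neq0 x d :
  primalFeasible M x -> exists pi, pi \in pool d.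
Proof.
case/andP=> + _; rewrite /= /masterRows !all_cat all_map.
case/andP=> /allP/(_ d) + _; rewrite mem_enum /= => /(_ isT).
have [pool0|[pi pi_d] _] := fset_0Vmem (pool d); last by exists pi.
rewrite /masterCols !big_cat /= !big_allpairs_dep big_map big_seq1 /=.
rewrite big1 => [|d' _]; last first.
  rewrite big1_seq // => pi /andP[_ pi_d']; have [dd'|] := eqVneq d d'.
    by move: pi_d'; rewrite -dd' pool0 in_fset0.
  by rewrite mul0r.
rewrite -mulr_sumr mul0r; under eq_bigr do rewrite -mulr_sumr mul0r.
by rewrite big1_eq mul0r !addr0 eq_sym oner_eq0.
Qed.

End Duals.

(* Segment paths have at most maxSeg + 1 nodes, so they form a finite type. *)
Lemma exists_min_trajectory (R : realFieldType) (I : instance) (d : demand I)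
    (f : trajectory I -> R) pi0 : Pi d pi0 ->
  exists2 pi, Pi d pi & forall pi', Pi d pi' -> f pi <= f pi'.
Proof.
pose W := {ffun 'I_(horizon I) -> {bseq (maxSeg I).+1 of vertex I}}.
pose tr (w : W) : trajectory I := [ffun t => w t : seq _].
have lift_tr pi : Pi d pi -> exists w, tr w = pi.
  move=> /forallP piP.
  have szP t : (size (pi t) <= (maxSeg I).+1)%N.
    have /and5P[_ _ /andP[_]] := piP t.
    rewrite /segments size_zip size_behead.
    by case: (pi t) => //= v p; rewrite (minn_idPr _).
  by exists [ffun t => Bseq (szP t)]; apply/ffunP => t; rewrite !ffunE.
move=> /[dup] P0 /lift_tr[w0 def0].
have P0w : Pi d (tr w0) by rewrite def0.
case: (arg_minP (P := fun w => Pi d (tr w)) (f \o tr) P0w) => w Pw le_w.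
exists (tr w) => // pi' /[dup] P' /lift_tr[w' def'].
by move: P'; rewrite -def' => /le_w.
Qed.

(** One arc from [false] to [true], one demand along it, unit data. The single period leaves no psi
    row, so a change in the data can only show in [theta]. *)
Definition oneArc : instance :=
  @Instance bool unit unit (fun=> false) (fun=> true) (fun=> 1) (fun=> 1) 1%N
    (fun=> set0) (fun=> false) (fun=> true) (fun _ _ => 1) (fun=> 0%N) 2
    (fun=> ltr01) (fun=> ltr01) isT (fun _ _ => erefl) (fun _ _ => ler01) isT.

(** * Paths and loads of the one-arc instance *)

Section OneArc.
Local Notation x0 :=
  ((tt, ord0) : Defs.arc oneArc * 'I_(horizon oneArc)).
Local Notation d0 := (tt : demand oneArc).

(** The empty path stays at [false], and no arc leaves [true] to continue a first one. *)
Lemma oneArc_arcPath p :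
  @arcPath oneArc ord0 false true p = (p == [:: tt]).
Proof.
case: p => [|[] [|[] p]] //=.
all: by rewrite /arcPath /alive /= ?inE /= ?in_set0 ?andbF.
Qed.

Lemma oneArc_forwarding : @forwarding oneArc ord0 false true tt.
Proof.
have lt1 : (1 < #|vertex oneArc|)%N by rewrite /= card_bool.
apply/existsP; exists (Ordinal lt1); apply/existsP; exists [tuple tt].
apply/andP; split=> //; rewrite /shortestPath oneArc_arcPath eqxx /=.
apply/forallP => n; apply/forallP => p; rewrite oneArc_arcPath.
by apply/implyP => /eqP->.
Qed.

Lemma oneArc_splitRatio : @splitRatio oneArc false true tt ord0 = 1.
Proof.
rewrite /splitRatio oneArc_forwarding /inflow /= card_bool /= /spread /=.
(* The flow is evaluated at the tail [false], which no arc enters: only the injected unit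
   remains. *)
rewrite big_pred0 => [|b]; last by rewrite andbF.
rewrite addr0 /outdeg (_ : [set _ | _] = [set tt]) ?cards1 ?divr1 //.
by apply/setP => -[]; rewrite !inE oneArc_forwarding.
Qed.

Lemma oneArc_arcTimes : arcTimes oneArc = [set x0].
Proof. by apply/setP => -[[] t]; rewrite !inE (ord1 t) /alive in_set0 eqxx. Qed.

Definition directTrajectory : trajectory oneArc := [ffun=> [:: false; true]].

Lemma directTrajectory_Pi : Pi (tt : demand oneArc) directTrajectory.
Proof.
apply/forallP => t; rewrite ffunE /segPath /= /validSegment /= !andbT.
by apply/connect1/existsP; exists tt; rewrite /alive in_set0.
Qed.

Lemma directTrajectory_Gamma :
  Gamma (tt : demand oneArc) (tt : Defs.arc oneArc) ord0 directTrajectory = 1.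
Proof.
rewrite /Gamma /= divr1 mul1r pair_bigA /= (bigD1 (false, true)) //= big1.
  by rewrite oneArc_splitRatio /delta ffunE !inE eqxx mulr1 addr0.
by move=> [i j] /negPf nij; rewrite /delta ffunE !inE nij mulr0.
Qed.

(** Reduces the comparison of [theta] across ranks to that of stratified duals. *)
Lemma oneArc_theta (R : realFieldType) k (y : mrow oneArc -> R) :
  theta k y (tt : demand oneArc) false true ord0 = - stratifiedDual k y x0.
Proof.
rewrite /theta (bigD1 tt) /=; last by rewrite oneArc_arcTimes inE.
rewrite big1 => [|[]]; last by rewrite andbF.
by rewrite oneArc_splitRatio divr1 mulr1 rmorph1 mulr1 addr0.
Qed.

(** * The Stela masters of ranks 1 and 2, written out, and their optimal duals *)

Variable R : realFieldType.
Let pool (d : demand oneArc) : {fset trajectory oneArc} :=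
  [fset directTrajectory]%fset.
(** The value 2 exceeds the load 1, so [NuRow 1] is slack; at value 1 it would be tight and a
    nonzero stratified dual could be optimal at rank 2. *)
Let lbar (j : nat) : R := 2.
Local Notation M k := (master pool lbar Stela k).

Lemma oneArc_demand : Finite.enum (demand oneArc) = [:: d0].
Proof. by rewrite unlock. Qed.

Lemma oneArc_later : enum (@later oneArc) = [::].
Proof.
by rewrite (@eq_enum _ _ pred0) ?enum0 // => t; rewrite inE [t]ord1.
Qed.

Lemma oneArc_pool :
  enum_fset [fset directTrajectory]%fset = [:: directTrajectory].
Proof.
(* A permutation of a list of length at most one is an equality. *)
apply: perm_small_eq => //; apply: uniq_perm; rewrite ?fset_uniq // => pi.
by rewrite mem_seq1 in_fset1.
Qed.

Lemma oneArc_cols1 : masterCols pool Stela 1 =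
  [:: XiCol d0 directTrajectory; LambdaCol x0; ZCol].
Proof.
by rewrite /masterCols oneArc_arcTimes enum_set1 enumT oneArc_demand /=
  oneArc_pool.
Qed.

Lemma oneArc_cols2 : masterCols pool Stela 2 =
  [:: XiCol d0 directTrajectory; LambdaCol x0; ZCol; AuxCol 2 x0].
Proof.
by rewrite /masterCols oneArc_arcTimes enum_set1 enumT oneArc_demand /=
  oneArc_pool.
Qed.

Lemma oneArc_rows1 : masterRows oneArc Stela 1 =
  [:: AlphaRow d0; EtaRow x0; MuRow x0].
Proof.
by rewrite /masterRows oneArc_arcTimes enum_set1 enumT oneArc_demand
  oneArc_later.
Qed.

Lemma oneArc_rows2 : masterRows oneArc Stela 2 =
  [:: AlphaRow d0; EtaRow x0; MuRow x0; NuRow 1 x0; RhoRow 2; SigmaRow;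
      YboundRow 2 x0].
Proof.
by rewrite /masterRows oneArc_arcTimes enum_set1 enumT oneArc_demand
  oneArc_later.
Qed.

Let ratr_Gamma : ratr (Gamma d0 x0.1 x0.2 directTrajectory) = 1 :> R.
Proof. by rewrite directTrajectory_Gamma rmorph1. Qed.

(** A point that serves both ranks: it is feasible, though not optimal, at rank 2. *)
Definition oneArc_primal (c : mcol oneArc) : R :=
  if c is AuxCol _ _ then 0 else 1.

Local Definition simp := (mulr1, mul1r, mul0r, mulr0, addr0, add0r).

Lemma oneArc_setting k : (k == 1%N) || (k == 2%N) ->
  masterSetting pool lbar Stela k.
Proof.
move=> k12; split; first by case/orP: k12 => /eqP->.
- move=> [] pi; rewrite in_fset1 => /eqP->; exact: directTrajectory_Pi.
- by move=> *; rewrite ler0n lexx.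
exists oneArc_primal; rewrite /primalFeasible /=.
case/orP: k12 => /eqP->.
  rewrite oneArc_rows1 oneArc_cols1 /= !big_cons !big_nil /=.
  by rewrite ratr_Gamma !simp ?addNr ?subrr ?lexx ?eqxx ?ler01.
rewrite oneArc_rows2 oneArc_cols2 /= !big_cons !big_nil /=.
by rewrite ratr_Gamma /= !simp ?addNr ?subrr ?lexx ?eqxx ?ler01 ?ler1n.
Qed.

(** The free column [ZCol] gives mu = -1, then the lambda column eta = 1, and the trajectory column
    alpha <= eta. *)
Lemma oneArc_feasible1 y : dualFeasible (M 1) y ->
  y (AlphaRow d0) <= 1 /\ stratifiedDual 1 y x0 = -1.
Proof.
rewrite /dualFeasible /stratifiedDual big_geq //= oneArc_rows1 oneArc_cols1 /=.
rewrite !big_cons !big_nil /= ratr_Gamma.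
by case/andP=> _ /and4P[? /eqP ? /eqP ? _]; split; lra.
Qed.

(** The trajectory and lambda columns give alpha <= eta = -(mu + nu), the auxiliary column rho +
    ybound <= 2 mu. As sigma <= 0, the value alpha + 2 nu + rho + 2 sigma + ybound is at most mu +
    nu. *)
Lemma oneArc_feasible2 y : dualFeasible (M 2) y ->
  dualValue (M 2) y <= stratifiedDual 2 y x0 <= 0.
Proof.
rewrite /dualFeasible /dualValue /stratifiedDual big_nat1 /=.
rewrite oneArc_rows2 oneArc_cols2 /= !big_cons !big_nil /=.
rewrite ratr_Gamma /lbar.
case/andP=> /and5P[? ? ? ? /andP[? _]] /and5P[? /eqP ? ? ? _].
by apply/andP; split; lra.
Qed.

Lemma oneArc_optimal1 : exists y, dualOptimal (M 1) y.
Proof.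
(* Here alpha = eta = 1 and mu = -1. At rank 1 the dual value is alpha, so this attains the bound
   alpha <= 1. *)
exists (fun r => if r is MuRow _ then -1 else 1); split.
  rewrite /dualFeasible /= oneArc_rows1 oneArc_cols1 /= !big_cons !big_nil /=.
  rewrite ratr_Gamma.
  by rewrite mulrNN !simp ?subrr ?addNr !lexx !eqxx lerN10.
move=> y' /oneArc_feasible1[le1 _]; rewrite /dualValue /= oneArc_rows1.
by rewrite !big_cons !big_nil /=; lra.
Qed.

Lemma oneArc_feasible0 : dualFeasible (M 2) (fun=> 0).
Proof.
rewrite /dualFeasible /= oneArc_rows2 oneArc_cols2 /= !big_cons !big_nil /=.
by rewrite !simp !lexx !eqxx ler01.
Qed.

Lemma oneArc_optimal2 : exists y, dualOptimal (M 2) y.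
Proof.
exists (fun=> 0); split; first exact: oneArc_feasible0.
move=> y' /oneArc_feasible2/andP[le1 le0].
by rewrite [leRHS]big1 ?(le_trans le1) // => r _; rewrite mul0r.
Qed.

(** Comparison with the zero dual gives 0 <= value <= stratified dual <= 0. *)
Lemma oneArc_optimal2_stratified y :
  dualOptimal (M 2) y -> stratifiedDual 2 y x0 = 0.
Proof.
case=> /oneArc_feasible2/andP[ley le0] /(_ _ oneArc_feasible0).
rewrite {1}/dualValue big1 => [ge0|r _]; last by rewrite mul0r.
by apply/le_anti; rewrite le0 (le_trans ge0).
Qed.
End OneArc.

Theorem theorem6 (R : realFieldType) :
  [/\ (* signs, reduced cost formula and pricing subproblem *)
      forall (I : instance) (pool : demand I -> {fset trajectory I})
             (lbar : nat -> R) (X : model) (k : nat) (y : mrow I -> R),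
        masterSetting pool lbar X k ->
        dualOptimal (master pool lbar X k) y ->
        [/\ forall x, x \in arcTimes I -> 0 <= - stratifiedDual k y x,
            forall t, later t -> 0 <= gamma y t,
            forall (d : demand I) (pi : trajectory I), Pi d pi ->
              reducedCost (master pool lbar X k) y (XiCol d pi) =
              - y (AlphaRow d)
              + \sum_(x in arcTimes I)
                   - stratifiedDual k y x * ratr (Gamma d x.1 x.2 pi)
              + \sum_(t | later t) gamma y t * ratr (beta d t pi),
            forall (d : demand I) i j t, 0 <= theta k y d i j t
          & forall d : demand I,
              (forall pi, Pi d pi ->
                 objective (pricing pool lbar X k y d) pi =
                 objective (chainProblem d (theta k y d) (gamma y)) pi)
              /\ exists v,
                   isMinimum (pricing pool lbar X k y d) v
                   /\ isMinimum (chainProblem d (theta k y d) (gamma y)) v],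
      (* the feasible set does not depend on (X, k) *)
      forall (I : instance) (d : demand I)
             (pool pool' : demand I -> {fset trajectory I})
             (lbar lbar' : nat -> R) (X X' : model) (k k' : nat)
             (y y' : mrow I -> R),
        feasible (pricing pool lbar X k y d) =1
        feasible (pricing pool' lbar' X' k' y' d)
    & (* the data (theta, gamma) do depend on (X, k) *)
      exists (I : instance) (pool : demand I -> {fset trajectory I})
             (lbar : nat -> R) (d : demand I) (X X' : model) (k k' : nat),
        [/\ masterSetting pool lbar X k,
            masterSetting pool lbar X' k',
            exists y, dualOptimal (master pool lbar X k) y,
            exists y', dualOptimal (master pool lbar X' k') y'
          & forall y y',
              dualOptimal (master pool lbar X k) y ->
              dualOptimal (master pool lbar X' k') y' ->
              (exists i j t, theta k y d i j t <> theta k' y' d i j t)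
              \/ (exists2 t, later t & gamma y t <> gamma y' t)]].
Proof.
split.
- move=> I pool lbar X k y [_ poolP _ [x fx]] [fy _].
  split=> [z|t|d pi _|d i j t|d].
  + by rewrite oppr_ge0; exact: stratifiedDual_le0 fy.
  + exact: gamma_ge0 fy.
  + exact: reducedCost_xi.
  + exact: theta_ge0 fy.
  have obj_eq := objective_pricing d fy.
  split=> [pi _|]; first exact: obj_eq.
  have [pi0 /poolP Ppi0] := primalFeasible_pool_neq0 d fx.
  have [pi Ppi min_pi] :=
    exists_min_trajectory (objective (pricing pool lbar X k y d)) Ppi0.
  exists (objective (pricing pool lbar X k y d) pi); split; split=> //.
  + by exists pi.
  + by exists pi => //; rewrite -obj_eq.
  + by move=> pi' /min_pi; rewrite -!obj_eq.
- by [].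
exists oneArc, (fun=> [fset directTrajectory]%fset), (fun=> 2), tt.
exists Stela, Stela, 1%N, 2%N; split.
- exact: oneArc_setting.
- exact: oneArc_setting.
- exact: oneArc_optimal1.
- exact: oneArc_optimal2.
move=> y y' [/oneArc_feasible1[_ y1] _] /oneArc_optimal2_stratified y'0.
(* On this segment [theta] is 1 at rank 1 and 0 at rank 2. *)
left; exists false, true, ord0.
rewrite !oneArc_theta y1 y'0 opprK oppr0; apply/eqP; exact: oner_neq0.
Qed.
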